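(* Let $\mathfrak g$ be a complex semisimple Lie algebra and consider its adjoint representation on $V = \mathfrak g$. Then the Lie algebra $\mathbb C[V]\otimes\mathfrak g$ of polynomial vector fields $\sum_k f_k \vec\xi_k$ ($f_k$ polynomial on $V$, $\xi_k\in\mathfrak g$) is generated, as a Lie algebra, by its $\mathfrak g$-overshears, i.e. by the vector fields $f\vec\xi$ with $f\in\mathbb C[V]$, $\xi\in\mathfrak g$ and $\vec\xi^{\,2} f = 0$.
   Context: For $\xi \in \mathfrak g$, $\vec\xi$ is the linear holomorphic vector field on $V = \mathfrak g$ given by $\vec\xi f(p) = \frac{d}{dt}|_{t=0} f(e^{t\,\mathrm{ad}\xi}p)$. Such vector fields are complete, and by a known result $f\vec\xi$ is then complete whenever $\vec\xi^{\,2}f=0$. *)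

(* Defs.v *)
From HB Require Import structures.
From mathcomp Require Import all_boot all_order all_algebra.
From mathcomp Require Import reals.
From mathcomp Require Import complex.
From mathcomp Require Import mpoly.
Set Implicit Arguments. Unset Strict Implicit. Unset Printing Implicit Defensive.
Import Order.TTheory GRing.Theory Num.Theory.
Local Open Scope ring_scope.

Section LieDefs.
Variables (C : comRingType) (n : nat).

(* A finite-dimensional Lie algebra g = C^n, given by structure constants
   c i j k : [e_i, e_j] = sum_k c i j k e_k.  Elements are coordinate vectors. *)
Definition lvec := 'I_n -> C.
Definition lzero : lvec := fun _ => 0.
Definition lcomb (a : C) (x y : lvec) : lvec := fun k => a * x k + y k.

Definition lbr (c : 'I_n -> 'I_n -> 'I_n -> C) (x y : lvec) : lvec :=
  fun k => \sum_(i < n) \sum_(j < n) x i * y j * c i j k.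

Definition is_lie_algebra (c : 'I_n -> 'I_n -> 'I_n -> C) : Prop :=
  (forall x : lvec, lbr c x x = lzero) /\
  (forall x y z : lvec,
     (fun k => lbr c x (lbr c y z) k + lbr c y (lbr c z x) k
               + lbr c z (lbr c x y) k) = lzero).

Definition lsubspace (I : lvec -> Prop) : Prop :=
  I lzero /\ forall a x y, I x -> I y -> I (lcomb a x y).

Definition lideal c (I : lvec -> Prop) : Prop :=
  lsubspace I /\ forall x y, I y -> I (lbr c x y).

Inductive lderived c (I : lvec -> Prop) : lvec -> Prop :=
| ld_zero : lderived c I lzero
| ld_br x y : I x -> I y -> lderived c I (lbr c x y)
| ld_comb a x y : lderived c I x -> lderived c I y -> lderived c I (lcomb a x y).

Fixpoint lderived_series c (I : lvec -> Prop) (k : nat) : lvec -> Prop :=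
  match k with
  | 0 => I
  | k'.+1 => lderived c (lderived_series c I k')
  end.

Definition lsolvable c (I : lvec -> Prop) : Prop :=
  exists k, forall x, lderived_series c I k x -> x = lzero.

Definition semisimple c : Prop :=
  forall I, lideal c I -> lsolvable c I -> forall x, I x -> x = lzero.

Definition vfield := 'I_n -> {mpoly C[n]}.

Definition vf_apply (X : vfield) (f : {mpoly C[n]}) : {mpoly C[n]} :=
  \sum_(j < n) X j * (mderiv j f).

Definition vf_smul (f : {mpoly C[n]}) (X : vfield) : vfield := fun k => f * X k.
Definition vf_add (X Y : vfield) : vfield := fun k => X k + Y k.
Definition vf_scale (a : C) (X : vfield) : vfield := fun k => a *: X k.
Definition vf_zero : vfield := fun _ => 0.
Definition vf_br (X Y : vfield) : vfield :=
  fun k => vf_apply X (Y k) - vf_apply Y (X k).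

(* The linear vector field xi-> : xi-> f (p) = d/dt|_0 f(e^{t ad xi} p),
   i.e. the vector field p |-> [xi, p] = ad xi (p). *)
Definition lin_vf c (xi : lvec) : vfield :=
  fun k => \sum_(i < n) \sum_(j < n) (xi i * c i j k) *: 'X_j.

Definition overshear c (X : vfield) : Prop :=
  exists (f : {mpoly C[n]}) (xi : lvec),
    vf_apply (lin_vf c xi) (vf_apply (lin_vf c xi) f) = 0 /\
    X = vf_smul f (lin_vf c xi).

Definition tensor_vf c (X : vfield) : Prop :=
  exists (m : nat) (f : 'I_m -> {mpoly C[n]}) (xi : 'I_m -> lvec),
    X = fun k => \sum_(l < m) f l * lin_vf c (xi l) k.

Inductive lie_generated (S : vfield -> Prop) : vfield -> Prop :=
| lg_base X : S X -> lie_generated S X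
| lg_zero : lie_generated S vf_zero
| lg_add X Y : lie_generated S X -> lie_generated S Y -> lie_generated S (vf_add X Y)
| lg_scale a X : lie_generated S X -> lie_generated S (vf_scale a X)
| lg_br X Y : lie_generated S X -> lie_generated S Y -> lie_generated S (vf_br X Y).

End LieDefs.

(* Main.v *)
Require Import Defs.
From HB Require Import structures.
From mathcomp Require Import all_boot all_order all_algebra.
From mathcomp Require Import boolp ring.
From mathcomp Require Import reals complex mpoly.
Set Implicit Arguments. Unset Strict Implicit. Unset Printing Implicit Defensive.
Import Order.TTheory GRing.Theory Num.Theory.
Local Open Scope ring_scope.

(** Let [L] be the Lie algebra generated by the overshears and [K] the Killing
    form, and put [l_y := K(y, .)].  The set of the [x] such that [f x] lies in
    [L] for all polynomials [f] is an ideal of [g]; the point is to show that it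
    contains every ad-diagonalizable [x].  For [[x, y] = a y] with [a <> 0], the
    fields [l_x x], [l_x y] and [l_x l_y y] are overshears.  Bracketing [l_x x]
    with [y] gives [l_y x] in [L], then [[l_y x, l_x x]] gives [l_x l_y x], and
    bracketing the latter with [y] gives [l_y^2 x].  A product [f] of [m]
    eigenforms with weights [a_i] is obtained from
    [[l x, h x] = (wt h - wt l) l h x], unless all the [a_i] are equal to half
    their sum; then either [m = 2], or the sum is [0] and [f x] is an overshear.

    It remains to see that an ideal [A] containing all ad-diagonalizable elements
    is [g].  For [x] in [g] let [D_x] act on the generalized [a]-eigenspace of
    [ad x] as the complex conjugate of [a].  As conjugation is additive, [D_x] is
    a derivation, and [tr (ad x D_x)] is the sum of the [|a|^2], so that it
    vanishes only if [ad x] is nilpotent.  By Engel's theorem, an ideal of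
    ad-nilpotent elements has a nonzero center unless it is [0], hence is [0] when
    [g] has no abelian ideal.  Applied to the [x] such that [tr (ad x D) = 0] for
    all derivations [D], this shows that [K] is nondegenerate, so that derivations
    are inner and [D_x = ad d] with [d] ad-diagonalizable.  Hence the orthogonal
    of [A] is an ideal of ad-nilpotent elements, so it is [0]. *)

(** * Conjugate of the semisimple part of a matrix *)

Lemma coprimep_XsubC_prod (F : fieldType) (k : nat) (a : F) (s : seq F) :
  a \notin s ->
  coprimep (('X - a%:P) ^+ k) (\prod_(b <- s) ('X - b%:P) ^+ k).
Proof.
elim: s => [|b s IHs]; first by rewrite big_nil coprimep1.
rewrite inE negb_or big_cons coprimepMr => /andP[ab /IHs ->]; rewrite andbT.
apply/coprimep_expl/coprimep_expr.
by rewrite coprimep_XsubC root_XsubC eq_sym.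
Qed.

(** Chinese remainder theorem, one root at a time: the Bezout relation between [('X - a%:P) ^+ k]
    and [q] corrects [p] at [a] without changing it modulo [q]. *)
Lemma poly_crt (F : fieldType) (k : nat) (phi : F -> F) (s : seq F) :
  uniq s ->
  exists p : {poly F},
    {in s, forall a, ('X - a%:P) ^+ k %| p - (phi a)%:P}.
Proof.
elim: s => [|a s IHs] /=; first by exists 0.
case/andP=> a_s /IHs [p pP].
pose q := \prod_(b <- s) ('X - b%:P) ^+ k.
have cop : coprimep (('X - a%:P) ^+ k) q.
  exact: coprimep_XsubC_prod.
have /Bezout_eq1_coprimepP [[u v] /= uv1] := cop.
exists (p + ((phi a)%:P - p) * v * q) => b; rewrite inE => /orP[/eqP ->|bs].
  have -> : p + ((phi a)%:P - p) * v * q - (phi a)%:P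
          = (p - (phi a)%:P) * u * ('X - a%:P) ^+ k.
    have vq : v * q = 1 - u * ('X - a%:P) ^+ k.
      by apply/eqP; rewrite eq_sym subr_eq -uv1 addrC.
    by rewrite -mulrA vq; ring.
  exact: dvdp_mull.
rewrite addrAC dvdp_add ?pP // dvdp_mull // /q.
by rewrite (big_rem b) //= dvdp_mulr.
Qed.

Section GeneralizedEigen.
Variables (C : numClosedFieldType) (n : nat) (M : 'M[C]_n.+1).

Lemma char_poly_split :
  {s : seq C | char_poly M = \prod_(a <- s) ('X - a%:P) & size s = n.+1}.
Proof.
have [s sP] := closed_field_poly_normal (char_poly M).
move: sP; rewrite (monicP (char_poly_monic M)) scale1r => sP.
exists s => //; have := size_char_poly M.
by rewrite sP size_prod_XsubC => -[].
Qed.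

(** Generalized eigenspace decomposition as an induction principle: by Cayley-Hamilton a product of
    pairwise coprime powers kills [v], and its kernel is split one factor at a time. *)
Lemma geigen_ind (P : 'rV[C]_n.+1 -> Prop) :
  (forall u v, P u -> P v -> P (u + v)) ->
  (forall u a, u *m (M - a%:M) ^+ n.+1 = 0 -> P u) ->
  forall v, P v.
Proof.
move=> PD Pg v; have [s sP ss] := char_poly_split.
have hornE (a : C) : horner_mx M (('X - a%:P) ^+ n.+1) = (M - a%:M) ^+ n.+1.
  by rewrite rmorphXn /= rmorphB /= horner_mx_X horner_mx_C.
pose q (t : seq C) := \prod_(a <- t) ('X - a%:P) ^+ n.+1.
have v0 : v *m horner_mx M (q (undup s)) = 0.
  (* Each root has multiplicity at most [size s = n.+1], the exponent used in [q]. *)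
  have /dvdpP [r ->] : char_poly M %| q (undup s).
    rewrite sP -big_undup_iterop_count /= /q.
    elim: (undup s) => [|a t IHt]; first by rewrite !big_nil.
    rewrite !big_cons dvdp_mul // -/(_ ^+ _).
    by apply: dvdp_exp2l; rewrite -ss count_size.
  by rewrite rmorphM /= Cayley_Hamilton mulr0 mulmx0.
elim: (undup s) (undup_uniq s) v v0 => [_ v|a t IHt /= /andP[a_t t_uniq] v].
  rewrite /q big_nil rmorph1 mulmx1 => ->.
  by apply: (Pg 0 0); rewrite mul0mx.
rewrite /q big_cons => v0.
have cop : coprimep (('X - a%:P) ^+ n.+1) (q t).
  exact: coprimep_XsubC_prod.
have : (v <= kermxpoly M (('X - a%:P) ^+ n.+1 * q t))%MS by apply/sub_kermxP.
rewrite kermxpolyM // => /sub_addsmxP [[u1 u2] ->] /=.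
apply: PD; last first.
  by apply: (IHt t_uniq); apply/sub_kermxP; rewrite -/(q t) submxMl.
by apply: (Pg _ a); rewrite -hornE; apply/sub_kermxP; apply: submxMl.
Qed.

Lemma trig_horner (T : 'M[C]_n.+1) (p : {poly C}) : is_trig_mx T ->
  is_trig_mx (horner_mx T p) /\ forall i, horner_mx T p i i = p.[T i i].
Proof.
move=> /is_trig_mxP Ttr; elim/poly_ind: p => [|p c [IHt IHd]].
  rewrite rmorph0; split=> [|i]; last by rewrite mxE horner0.
  by apply/is_trig_mxP => i j _; rewrite mxE.
rewrite rmorphD rmorphM /= horner_mx_X horner_mx_C.
have {}IHt := is_trig_mxP IHt.
split=> [|i].
  apply/is_trig_mxP => i j ij; rewrite !mxE big1 ?add0r; last first.
    move=> k _; have [ik|ki] := ltnP i k; first by rewrite IHt // mul0r.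
    by rewrite Ttr ?mulr0 // (leq_ltn_trans ki ij).
  by rewrite -val_eqE /= (ltn_eqF ij) mulr0n.
rewrite !mxE eqxx mulr1n (bigD1 i) //= big1 ?addr0; last first.
  move=> k ki; have [ik|ik] := ltnP i k; first by rewrite IHt // mul0r.
  by rewrite Ttr ?mulr0 // ltn_neqAle ik andbT.
by rewrite IHd hornerMXaddC.
Qed.

(** [D] is a polynomial in [M]. The exponent [n.+1 + n.+1] leaves room for the bracket of two
    generalized eigenvectors, where exponents add up. *)
Lemma conj_semisimple_part :
  exists D : 'M[C]_n.+1,
    [/\ forall (u : 'rV_n.+1) a,
          u *m (M - a%:M) ^+ (n.+1 + n.+1) = 0 -> u *m D = a^* *: u
      & \tr (M *m D) = 0 -> M ^+ n.+1 = 0].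
Proof.
have [s sP ss] := char_poly_split.
have [p pP] := poly_crt (n.+1 + n.+1) (fun a => a^*) (undup_uniq s).
exists (horner_mx M p); split=> [u a|].
  have <- : horner_mx M (('X - a%:P) ^+ (n.+1 + n.+1)) = (M - a%:M) ^+ (n.+1 + n.+1).
    by rewrite rmorphXn /= rmorphB /= horner_mx_X horner_mx_C.
  move=> u0; have [a_s|a_s] := boolP (a \in s).
    have /dvdpP [r rP] := pP a (etrans (mem_undup s a) a_s).
    have -> : p = ('X - a%:P) ^+ (n.+1 + n.+1) * r + (a^*)%:P.
      by rewrite mulrC -rP subrK.
    rewrite rmorphD rmorphM /= horner_mx_C mulmxDr mulmxA u0 mul0mx add0r.
    by rewrite mul_mx_scalar.
  (* If [a] is not a root of [char_poly M], the two kernels containing [u] meet only in 0. *)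
  have cop : coprimep (('X - a%:P) ^+ (n.+1 + n.+1)) (char_poly M).
    by rewrite coprimep_expl // coprimep_sym sP coprimep_XsubC root_prod_XsubC.
  suff -> : u = 0 by rewrite mul0mx scaler0.
  apply/eqP; rewrite -submx0 -(mxdirect_kermxpoly M cop) sub_capmx.
  by apply/andP; split; apply/sub_kermxP; rewrite // Cayley_Hamilton mulmx0.
(* In triangular form the trace is a sum of eigenvalues times their conjugates. If it vanishes, all
   eigenvalues are 0 and Cayley-Hamilton reads [T ^+ n.+1 = 0]. *)
have [P Pu] := Schur M (ltn0Sn n); have {}Pu := unitarymx_unit Pu.
rewrite /similar_to conjumx //; set T := P *m M *m invmx P => Ttr.
have TE q : horner_mx T q = P *m horner_mx M q *m invmx P.
  exact: horner_mx_uconj.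
have [DTtr DTd] := trig_horner p Ttr.
have -> : \tr (M *m horner_mx M p) = \sum_i `|T i i| ^+ 2.
  have -> : \tr (M *m horner_mx M p) = \tr (T *m horner_mx T p).
    rewrite TE /T (mxtrace_mulC (P *m M *m _)) !mulmxA mulmxKV //.
    rewrite -!mulmxA mxtrace_mulC !mulmxA mulmxKV //.
    by rewrite mxtrace_mulC.
  apply: eq_bigr => i _; rewrite mxE (bigD1 i) //= big1 ?addr0; last first.
    move=> k ki; have [ik|ik] := ltnP i k.
      by rewrite (is_trig_mxP Ttr) // mul0r.
    by rewrite (is_trig_mxP DTtr) ?mulr0 // ltn_neqAle ik andbT.
  rewrite DTd normCK; congr (_ * _).
  have Ts : T i i \in s.
    rewrite -root_prod_XsubC -sP -root_mxminpoly -(mxminpoly_uconj _ Pu).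
    rewrite conjumx // root_mxminpoly char_poly_trig //.
    by rewrite (bigD1 i) //= rootM root_XsubC eqxx.
  have := pP _ (etrans (mem_undup s _) Ts).
  rewrite addnS exprS => /(dvdp_trans (dvdp_mulIl _ _)).
  by rewrite dvdp_XsubCl rootE hornerD hornerN hornerC subr_eq0 => /eqP.
move=> /eqP; rewrite psumr_eq0 => [|i _]; last exact: exprn_ge0.
move=> /allP Td.
have T0 i : T i i = 0.
  by have := Td i (mem_index_enum i); rewrite expf_eq0 normr_eq0 /= => /eqP.
have : horner_mx T (char_poly T) = 0 by exact: Cayley_Hamilton.
rewrite char_poly_trig // (eq_bigr (fun=> 'X)) => [|i _]; last by rewrite T0 subr0.
rewrite prodr_const card_ord TE rmorphXn /= horner_mx_X => PM0.
by rewrite -[LHS](mulKmx Pu) -[P *m _](mulmxKV Pu) PM0 mul0mx mulmx0.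
Qed.
End GeneralizedEigen.

(** * Semisimple Lie algebras *)

Section Subspace.
Variables (F : fieldType) (n : nat).

Definition subspace (A : 'rV[F]_n -> Prop) : Prop :=
  A 0 /\ forall a x y, A x -> A y -> A (a *: x + y).

Lemma subspace_addsmx (A : 'rV[F]_n -> Prop) (W : 'M[F]_n) x v :
  subspace A -> (forall w, (w <= W)%MS -> A w) -> A x ->
  (v <= W + x)%MS -> A v.
Proof.
move=> [_ Alin] WA Ax /sub_addsmxP [[u1 u2] /= ->].
rewrite addrC [u2]mx11_scalar mul_scalar_mx.
by apply: Alin => //; apply/WA/submxMl.
Qed.

Lemma rank_addsmx_gt (W : 'M[F]_n) (x : 'rV[F]_n) :
  ~~ (x <= W)%MS -> (\rank W < \rank (W + x)%MS)%N.
Proof.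
move=> xW; have := mxrank_leqif_sup (addsmxSl W x).
move=> [le /esym eqr]; rewrite ltn_neqAle le andbT -eqr.
by apply: contra xW; apply: submx_trans; apply: addsmxSr.
Qed.

(** [W] grows by one vector of [A] at a time, which stops since its rank is bounded by [n]; [Q] is
    an invariant carried along, such as the vanishing of brackets in Engel's theorem. *)
Lemma subspace_exhaust (A : 'rV[F]_n -> Prop) (Q : 'M[F]_n -> Prop) :
  subspace A -> Q 0 ->
  (forall W, Q W -> (forall w, (w <= W)%MS -> A w) ->
     (exists2 z, A z & ~~ (z <= W)%MS) ->
     exists x, [/\ A x, ~~ (x <= W)%MS & Q (W + x)%MS]) ->
  exists2 W, Q W & forall v, A v <-> (v <= W)%MS.
Proof.
move=> Asub Q0 Qext.
suff ext k W : (n - \rank W < k)%N -> Q W -> (forall w, (w <= W)%MS -> A w) ->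
    exists2 W', Q W' & forall v, A v <-> (v <= W')%MS.
  apply: (ext n.+1 0) => // [|w]; first by rewrite ltnS leq_subr.
  by rewrite submx0 => /eqP ->; case: Asub.
elim: k W => // k IHk W rW QW WA.
have [ex|nex] := EM (exists2 z, A z & ~~ (z <= W)%MS).
  have [x [Ax xW QWx]] := Qext W QW WA ex.
  apply: (IHk (W + x)%MS) => //; last first.
    by move=> w; apply: subspace_addsmx.
  have := rank_addsmx_gt xW; have := rank_leq_col (W + x)%MS.
  move: rW; rewrite !ltnS; set r := \rank W; set r' := \rank _ => rk r'n rr'.
  apply: leq_trans rk; apply: ltn_sub2l => //.
  exact: leq_trans rr' r'n.
exists W => // v; split=> [Av|]; last exact: WA.
by apply: contrapT => vW; apply: nex; exists v => //; apply/negP.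
Qed.

Lemma subspace_mx (A : 'rV[F]_n -> Prop) :
  subspace A -> exists W : 'M[F]_n, forall v, A v <-> (v <= W)%MS.
Proof.
move=> Asub; have [W _ WP] := @subspace_exhaust A (fun=> True) Asub I
  (fun W _ _ '(ex_intro2 z Az zW) => ex_intro _ z (And3 Az zW I)).
by exists W.
Qed.

End Subspace.

Section LieAlgebra.
Variables (C : numClosedFieldType) (n : nat).
Notation g := 'rV[C]_n.+1.
Variable br : g -> g -> g.
Hypothesis br_linl : forall a x y z, br (a *: x + y) z = a *: br x z + br y z.
Hypothesis br_linr : forall a x y z, br z (a *: x + y) = a *: br z x + br z y.
Hypothesis brxx : forall x, br x x = 0.
Hypothesis br_leibniz :
  forall x y z, br x (br y z) = br (br x y) z + br y (br x z).

Lemma br0 x : br x 0 = 0.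
Proof. by have := br_linr (-1) 0 0 x; rewrite scaler0 addr0 scaleN1r addNr. Qed.
Lemma br0l x : br 0 x = 0.
Proof. by have := br_linl (-1) 0 0 x; rewrite scaler0 addr0 scaleN1r addNr. Qed.
Lemma brDr x y z : br x (y + z) = br x y + br x z.
Proof. by rewrite -[y]scale1r br_linr !scale1r. Qed.
Lemma brDl x y z : br (x + y) z = br x z + br y z.
Proof. by rewrite -[x]scale1r br_linl !scale1r. Qed.
Lemma brZr a x y : br x (a *: y) = a *: br x y.
Proof. by rewrite -[a *: y]addr0 br_linr br0 addr0. Qed.
Lemma brZl a x y : br (a *: x) y = a *: br x y.
Proof. by rewrite -[a *: x]addr0 br_linl br0l addr0. Qed.
Lemma brC x y : br x y = - br y x.
Proof.
apply/eqP; rewrite -addr_eq0; have := brxx (x + y).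
by rewrite brDr !brDl !brxx add0r addr0 addrC => ->.
Qed.

Definition ad (x : g) : 'M[C]_n.+1 := \matrix_i br x (delta_mx 0 i).

Lemma mul_ad v x : v *m ad x = br x v.
Proof.
rewrite mulmx_sum_row [in RHS](row_sum_delta v).
elim/big_rec2: _ => [|i y1 y2 _ ->]; first by rewrite br0.
by rewrite br_linr rowK.
Qed.

Lemma ad_lin a x y : ad (a *: x + y) = a *: ad x + ad y.
Proof.
by apply/row_matrixP => i; rewrite linearP /= !rowK br_linl.
Qed.

Lemma ad0 : ad 0 = 0.
Proof. by apply/row_matrixP => i; rewrite rowK row0 br0l. Qed.

Lemma adN x : ad (- x) = - ad x.
Proof. by have := ad_lin (-1) x 0; rewrite addr0 ad0 addr0 !scaleN1r. Qed.

(** Matrices act on row vectors from the right, so the products appear in the reverse of the usual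
    order. *)
Lemma ad_br x y : ad (br x y) = ad y *m ad x - ad x *m ad y.
Proof.
apply/row_matrixP => i; rewrite !rowE mulmxBr !mulmxA !mul_ad.
by rewrite br_leibniz addrK.
Qed.

Definition ideal (A : g -> Prop) : Prop :=
  subspace A /\ forall x y, A y -> A (br x y).

(** * Engel's theorem *)

(* [vanishing W v]: iterated brackets [w_k, ... [w_1, v]] with [w_i] in [W]
   eventually vanish, the number of steps being allowed to depend on the [w_i]. *)
Inductive vanishing (W : g -> Prop) : g -> Prop :=
| vanishing0 : vanishing W 0
| vanishingS v : (forall w, W w -> vanishing W (br w v)) -> vanishing W v.

Lemma vanishing_lin W a u v :
  vanishing W u -> vanishing W v -> vanishing W (a *: u + v).
Proof.
move=> Wu; elim: Wu v => [v|{}u Wu IHu v Wv]; first by rewrite scaler0 add0r.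
apply: vanishingS => w Ww; rewrite br_linr; apply: IHu => //.
by case: Wv => [|{}v]; [rewrite br0; apply: vanishing0 | apply].
Qed.

(** Adjoins to [W] an ad-nilpotent [x] normalizing it. The claim is strengthened to all
    [iter j (br x) v], since a bracket with [c *: x + w] yields one term that raises [j] and one
    that uses an element of [W]. *)
Lemma vanishing_extend (W W' : g -> Prop) x k :
  (forall y, W' y -> exists w c, W w /\ y = c *: x + w) ->
  (forall w, W w -> W (br w x)) ->
  (forall v, iter k (br x) v = 0) ->
  (forall v, vanishing W v) -> forall v, vanishing W' v.
Proof.
move=> W'P Wx xk WP v.
suff: forall j, vanishing W' (iter j (br x) v) by move/(_ 0%N).
elim: (WP v) => [|{WP} {}v _ IH] j.
  suff -> : iter j (br x) 0 = 0 by apply: vanishing0.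
  by elim: j => //= j ->; rewrite br0.
(* An element of [W] moves inwards past the powers of [x], as each [br w x] is again in [W]. *)
have IH' : forall l w i, W w ->
    vanishing W' (iter i (br x) (br w (iter l (br x) v))).
  elim=> [|l IHl] w i Ww /=; first exact: IH.
  have -> : br w (br x (iter l (br x) v)) =
      br x (br w (iter l (br x) v)) + br (br w x) (iter l (br x) v).
    by rewrite br_leibniz addrC.
  have -> : forall a b,
      iter i (br x) (a + b) = 1 *: iter i (br x) a + iter i (br x) b.
    by move=> a b; elim: (i) => [|m /= ->]; rewrite !scale1r // brDr.
  apply: vanishing_lin; last exact/IHl/Wx.
  by rewrite -iterSr; apply: IHl.
(* Downward induction on [j]: the iterate is 0 as soon as [k <= j]. *)
have [m] := ubnP (k - j); elim: m j => // m IHm j; rewrite ltnS => kj.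
have [kj'|jk] := leqP k j.
  rewrite -(subnK kj') addnC iterD xk; apply: vanishing0.
apply: vanishingS => y /W'P [w [c [Ww ->]]]; rewrite br_linl.
apply: vanishing_lin; last exact: (IH' j w 0).
by apply: (IHm j.+1); apply: leq_trans kj; apply: ltn_sub2l.
Qed.

Lemma expr_ad x k v : v *m ad x ^+ k = iter k (br x) v.
Proof.
elim: k => [|k IHk]; first by rewrite expr0 mulmx1.
by rewrite exprSr mulmxA IHk mul_ad.
Qed.

Lemma nil_vanishing (A : g -> Prop) k :
  subspace A -> (forall x y, A x -> A y -> A (br x y)) ->
  (forall x, A x -> ad x ^+ k = 0) ->
  forall v, vanishing A v.
Proof.
move=> Asub Abr Anil.
have [|W QW WA [z Az zW]|W WP WA] :=
    @subspace_exhaust _ _ A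
      (fun W => forall v, vanishing (fun w => (w <= W)%MS) v) Asub.
- move=> v; apply: vanishingS => w; rewrite submx0 => /eqP ->.
  by rewrite br0l; apply: vanishing0.
(* Starting from [z], bracket with elements of [W] as long as the result stays outside [W]. By [QW]
   this stops, at a vector that normalizes [W]. *)
- have [x [Ax xW Wx]] : exists x, [/\ A x, ~~ (x <= W)%MS &
      forall w, (w <= W)%MS -> (br w x <= W)%MS].
    elim: (QW z) Az zW => [|{}z _ IHz Az zW]; first by rewrite sub0mx.
    have [wz|nwz] := EM (forall w, (w <= W)%MS -> (br w z <= W)%MS).
      by exists z.
    have /existsNP [w /not_implyP [wW /negP wzW]] := nwz.
    by apply: (IHz w wW) => //; apply: Abr => //; apply: WA.
  exists x; split=> //; apply: (vanishing_extend (x := x) (k := k)) QW => //.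
    move=> y /sub_addsmxP [[u1 u2] /= ->].
    exists (u1 *m W), (u2 0 0); rewrite submxMl; split=> //.
    by rewrite addrC {1}[u2]mx11_scalar mul_scalar_mx.
  by move=> v; rewrite -expr_ad Anil // mulmx0.
move=> v; elim: (WP v) => [|{}v _ IH]; first exact: vanishing0.
by apply: vanishingS => w /WA; apply: IH.
Qed.

Hypothesis no_abelian_ideal : forall A : g -> Prop, ideal A ->
  (forall x y, A x -> A y -> br x y = 0) -> forall x, A x -> x = 0.

(** The center [Z] of [A] is an abelian ideal of the whole algebra, hence 0. By induction on
    [vanishing], all brackets of [x] with [A] are 0, so [x] lies in [Z]. *)
Lemma nil_ideal0 (A : g -> Prop) k : ideal A ->
  (forall x, A x -> ad x ^+ k = 0) -> forall x, A x -> x = 0.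
Proof.
move=> [[A0 Alin] Abr] Anil x Ax.
pose Z z := A z /\ forall w, A w -> br w z = 0.
have Z0 : forall z, Z z -> z = 0.
  apply: no_abelian_ideal => [|y z [Ay _] [_]]; last exact.
  split; first split.
  - by split=> // w _; rewrite br0.
  - move=> a y z [Ay Zy] [Az Zz]; split; first exact: Alin.
    by move=> w Aw; rewrite br_linr Zy // Zz // scaler0 addr0.
  move=> y z [Az Zz]; split; first exact: Abr.
  move=> w Aw; rewrite br_leibniz (Zz _ Aw) br0 addr0 Zz //.
  by rewrite brC -scaleN1r -[_ *: _]addr0; apply: Alin => //; apply: Abr.
have Avan := nil_vanishing (conj A0 Alin) (fun x y _ => @Abr x y) Anil x.
elim: Avan Ax => // {}x _ IH Ax; apply: Z0; split=> // w Aw.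
by apply: IH => //; apply: Abr.
Qed.

(** * Derivations and the Killing form *)

Definition derivation (D : 'M[C]_n.+1) : Prop :=
  forall x y, br x y *m D = br (x *m D) y + br x (y *m D).

Lemma ad_derivation x : derivation (ad x).
Proof. by move=> y z; rewrite !mul_ad br_leibniz. Qed.

Definition killing (x y : g) : C := \tr (ad x *m ad y).

Lemma killingC x y : killing x y = killing y x.
Proof. exact: mxtrace_mulC. Qed.

Lemma killing_linl a x y z :
  killing (a *: x + y) z = a * killing x z + killing y z.
Proof. by rewrite /killing ad_lin mulmxDl -scalemxAl linearP. Qed.

Lemma killingNl x y : killing (- x) y = - killing x y.
Proof. by rewrite /killing adN mulNmx raddfN. Qed.

Lemma derivation_ad D z : derivation D -> ad z *m D - D *m ad z = ad (z *m D).
Proof.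
move=> Dder; apply/row_matrixP => i; rewrite !rowE mulmxBr !mulmxA !mul_ad.
by rewrite Dder addrK.
Qed.

(** [ad (z *m D)] is the commutator of [ad z] and [D], and the trace is cyclic. For inner [D] this
    is the invariance of [killing]. *)
Lemma tr_ad_br_derivation D y z : derivation D ->
  \tr (ad (br y z) *m D) = - killing y (z *m D).
Proof.
move=> Dder; rewrite /killing -derivation_ad // ad_br mulmxBl mulmxBr.
rewrite !linearB /=.
rewrite opprB; congr (_ - _); last by rewrite mulmxA.
by rewrite -mulmxA mxtrace_mulC mulmxA.
Qed.

Lemma killing_br x y z : killing (br x y) z = killing x (br y z).
Proof.
rewrite {1}/killing tr_ad_br_derivation; last exact: ad_derivation.
by rewrite mul_ad (brC z) killingC killingNl opprK killingC.
Qed.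

(** By the Leibniz rule [ad x - (a + b)] sends [br u v] to a sum of two brackets, each with one
    exponent lowered; hence an induction on [i + j]. *)
Lemma geigen_br x u v a b i j :
  u *m (ad x - a%:M) ^+ i = 0 -> v *m (ad x - b%:M) ^+ j = 0 ->
  br u v *m (ad x - (a + b)%:M) ^+ (i + j) = 0.
Proof.
have step w e k : w *m (ad x - e%:M) ^+ k.+1 =
    (br x w - e *: w) *m (ad x - e%:M) ^+ k.
  by rewrite exprS mulmxA mulmxBr mul_ad mul_mx_scalar.
have [m] := ubnP (i + j); elim: m i j u v => // m IHm [|i] j u v.
  by move=> _; rewrite expr0 mulmx1 => -> _; rewrite br0l mul0mx.
case: j => [_ _|j].
  by rewrite expr0 mulmx1 => ->; rewrite br0 mul0mx.
rewrite ltnS => ijm u0 v0; rewrite addSn step.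
have -> : br x (br u v) - (a + b) *: br u v =
    br (br x u - a *: u) v + br u (br x v - b *: v).
  rewrite brDl brDr -!scaleNr brZl brZr br_leibniz.
  by rewrite scaleNr scalerDl !scaleNr opprD addrACA.
rewrite mulmxDl IHm ?add0r //; last by rewrite -step.
by rewrite addnS -addSn IHm // -?step // addSn -addnS.
Qed.

(* Impredicative form of: the eigenvectors of [ad d] span. *)
Definition ad_diagonalizable (d : g) : Prop :=
  forall P : g -> Prop, (forall u v, P u -> P v -> P (u + v)) ->
  (forall u a, br d u = a *: u -> P u) -> forall v, P v.

Lemma conj_derivation x : exists2 D, derivation D &
  (\tr (ad x *m D) = 0 -> ad x ^+ n.+1 = 0) /\
  (forall d, D = ad d -> ad_diagonalizable d).
Proof.
have [D [Deig Dtr]] := conj_semisimple_part (ad x).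
have Deig' (u : g) a : u *m (ad x - a%:M) ^+ n.+1 = 0 -> u *m D = a^* *: u.
  by move=> u0; apply: Deig; rewrite exprD mulmxA u0 mul0mx.
exists D.
  apply: (@geigen_ind _ _ (ad x)) => [u v Du Dv y|u a ua].
    by rewrite !brDl !mulmxDl Du Dv brDl addrACA.
  apply: (@geigen_ind _ _ (ad x)) => [v w Dv Dw|v b vb].
    by rewrite !brDr !mulmxDl Dv Dw brDr addrACA.
  rewrite (Deig _ (a + b)); last exact: geigen_br.
  by rewrite (Deig' _ _ ua) (Deig' _ _ vb) rmorphD /= scalerDl brZl brZr.
split=> // d Dd P PD Pe; apply: (@geigen_ind _ _ (ad x)) => // u a /Deig'.
by rewrite Dd mul_ad; apply: Pe.
Qed.

(** [N] involves all derivations because the conjugate derivation is not yet known to be inner. For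
    [x] in the radical, every [br x y] lies in [N], so [x] is central. *)
Lemma killing_nondegenerate x : (forall y, killing x y = 0) -> x = 0.
Proof.
pose N x := forall D, derivation D -> \tr (ad x *m D) = 0.
have N0 : forall x, N x -> x = 0.
  apply: (@nil_ideal0 N n.+1) => [|y Ny]; last first.
    by have [D Dder [Dtr _]] := conj_derivation y; apply/Dtr/Ny.
  split; first split.
  - by move=> D _; rewrite ad0 mul0mx mxtrace0.
  - move=> a y z Ny Nz D Dd; rewrite ad_lin mulmxDl -scalemxAl linearP /=.
    by rewrite Ny // Nz // mulr0 addr0.
  move=> y z Nz D Dd; rewrite brC adN mulNmx raddfN /= tr_ad_br_derivation //.
  by rewrite opprK /killing Nz //; apply: ad_derivation.
move=> Kx; pose Z z := forall y, br z y = 0.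
suff : Z x.
  apply: no_abelian_ideal; last by move=> y z /(_ z).
  split; first split=> [y|a y z Zy Zz w]; rewrite ?br0l //.
    by rewrite br_linl Zy Zz scaler0 addr0.
  by move=> y z Zz w; rewrite [br y z]brC Zz oppr0 br0l.
by move=> y; apply: N0 => D Dd; rewrite tr_ad_br_derivation // Kx oppr0.
Qed.

Lemma linear_form_sum (f : g -> C) :
  (forall a x y, f (a *: x + y) = a * f x + f y) ->
  forall x, f x = \sum_i x 0 i * f (delta_mx 0 i).
Proof.
move=> flin x; rewrite {1}(row_sum_delta x).
elim/big_rec2: _ => [|i y1 y2 _ <-]; last exact: flin.
by have := flin (-1) 0 0; rewrite scaler0 addr0 mulN1r addNr.
Qed.

Definition killing_mx : 'M[C]_n.+1 :=
  \matrix_(i, j) killing (delta_mx 0 i) (delta_mx 0 j).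

Lemma mul_killing_mx x j : (x *m killing_mx) 0 j = killing x (delta_mx 0 j).
Proof.
rewrite mxE [RHS](linear_form_sum (f := fun x => killing x _)) => [|a y z].
  by apply: eq_bigr => i _; rewrite mxE.
exact: killing_linl.
Qed.

Lemma killing_mxE x y : killing x y = (x *m killing_mx *m y^T) 0 0.
Proof.
rewrite killingC mxE [LHS](linear_form_sum (f := fun y => killing y _)).
  apply: eq_bigr => i _.
  by rewrite mul_killing_mx mxE [killing _ x]killingC mulrC.
by move=> a z w; apply: killing_linl.
Qed.

Lemma killing_mx_unit : killing_mx \in unitmx.
Proof.
rewrite -row_free_unit -kermx_eq0; apply/rowV0P => v /sub_kermxP v0.
by apply: killing_nondegenerate => y; rewrite killing_mxE v0 mul0mx mxE.
Qed.

(** Nondegeneracy gives [d] with [tr (D ad y) = K(d, y)]. The derivation [E = D - ad d] is then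
    trace-orthogonal to every [ad y], so [K(y, z E) = - tr (ad [y, z] E) = 0]. *)
Lemma derivation_inner D : derivation D -> exists d, D = ad d.
Proof.
move=> Dder.
pose t : g := \row_j \tr (D *m ad (delta_mx 0 j)).
exists (t *m invmx killing_mx); set d := _ *m _.
have trD y : \tr (D *m ad y) = killing d y.
  rewrite killing_mxE mulmxKV ?killing_mx_unit // mxE.
  rewrite (linear_form_sum (f := fun y => \tr (D *m ad y))) => [|a z w].
    by apply: eq_bigr => i _; rewrite !mxE mulrC.
  by rewrite ad_lin mulmxDr -scalemxAr linearP.
have Eder : derivation (D - ad d).
  move=> x y; rewrite !mulmxBr Dder ad_derivation !brDr !brDl.
  by rewrite -!scaleN1r brZl brZr scalerDr addrACA.
apply/subr0_eq/row_matrixP => i; rewrite row0 rowE.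
apply: killing_nondegenerate => y; rewrite killingC; apply/eqP.
rewrite -oppr_eq0 -tr_ad_br_derivation // mxtrace_mulC mulmxBl raddfB /= trD.
by rewrite /killing subrr.
Qed.

Lemma conj_diagonalizable x : exists2 d, ad_diagonalizable d &
  (killing x d = 0 -> ad x ^+ n.+1 = 0).
Proof.
have [D Dder [Dtr Ddiag]] := conj_derivation x.
have [d Dd] := derivation_inner Dder.
by exists d; [apply: Ddiag | rewrite /killing -Dd].
Qed.

Lemma diagonalizable_ideal (A : g -> Prop) : ideal A ->
  (forall d, ad_diagonalizable d -> A d) -> forall x, A x.
Proof.
move=> [Asub Abr] Adiag x; have [W WA] := subspace_mx Asub.
have Aperp0 y : (forall a, A a -> killing y a = 0) -> y = 0.
  move: y; apply: (@nil_ideal0 _ n.+1) => [|y Ky]; last first.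
    by have [d /Adiag Ad] := conj_diagonalizable y; apply; apply: Ky.
  split; first split=> [a Aa|e y z Ky Kz a Aa].
  - by rewrite killing_mxE !mul0mx mxE.
  - by rewrite killing_linl Ky // Kz // mulr0 addr0.
  move=> y z Kz a Aa; rewrite brC killingNl killing_br Kz ?oppr0 //.
  exact: Abr.
apply/WA; suff /row_fullP [B BW] : row_full W.
  by rewrite -[x]mulmx1 -BW mulmxA submxMl.
(* A vector [v] orthogonal to the rows of [W] for the dot product becomes orthogonal to [A] for
   [killing] after multiplication by [invmx killing_mx]. *)
rewrite /row_full -mxrank_tr -/(row_free W^T) -kermx_eq0.
apply/rowV0P => v /sub_kermxP v0.
suff : v *m invmx killing_mx = 0.
  move=> /(congr1 (mulmx^~ killing_mx)).
  by rewrite mulmxKV ?killing_mx_unit // mul0mx.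
apply: Aperp0 => a /WA /submxP [u ->].
rewrite killing_mxE mulmxKV ?killing_mx_unit //.
by rewrite trmx_mul mulmxA v0 mul0mx mxE.
Qed.

End LieAlgebra.

(** * Overshears *)

Section VectorFields.
Variables (F : fieldType) (n : nat).
Implicit Types (X Y Z : vfield F n) (f g : {mpoly F[n]}).

Lemma vf_apply_lin X a f g :
  vf_apply X (a *: f + g) = a *: vf_apply X f + vf_apply X g.
Proof.
rewrite /vf_apply scaler_sumr -big_split; apply: eq_bigr => j _ /=.
by rewrite mderivD mderivZ mulrDr scalerAr.
Qed.

Lemma vf_applyM X f g :
  vf_apply X (f * g) = f * vf_apply X g + g * vf_apply X f.
Proof.
rewrite /vf_apply !mulr_sumr -big_split; apply: eq_bigr => j _ /=.
by rewrite mderivM; ring.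
Qed.

Lemma vf_apply1 X : vf_apply X 1 = 0.
Proof. by rewrite /vf_apply big1 // => j _; rewrite mderivC mulr0. Qed.

Lemma vf_apply0 X : vf_apply X 0 = 0.
Proof. by rewrite /vf_apply big1 // => j _; rewrite mderiv0 mulr0. Qed.

Lemma vf_applyZ X a f : vf_apply X (a *: f) = a *: vf_apply X f.
Proof. by have := vf_apply_lin X a f 0; rewrite vf_apply0 !addr0. Qed.

Lemma vf_br_smul f X g Y :
  vf_br (vf_smul f X) (vf_smul g Y) =
  fun k => f * vf_apply X g * Y k - g * vf_apply Y f * X k
           + f * g * vf_br X Y k.
Proof.
apply: funext => k; rewrite /vf_br.
have E h Z h' : vf_apply (vf_smul h Z) h' = h * vf_apply Z h'.
  by rewrite /vf_apply mulr_sumr; apply: eq_bigr => j _; rewrite mulrA.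
by rewrite !E /vf_smul !vf_applyM; ring.
Qed.

Lemma vf_br_addl X Y Z : vf_br (vf_add X Y) Z = vf_add (vf_br X Z) (vf_br Y Z).
Proof.
apply: funext => k; rewrite /vf_br /vf_add.
have -> : vf_apply (fun k => X k + Y k) (Z k) =
    vf_apply X (Z k) + vf_apply Y (Z k).
  by rewrite /vf_apply -big_split; apply: eq_bigr => j _; rewrite mulrDl.
by rewrite -[X k]scale1r vf_apply_lin !scale1r; ring.
Qed.

Lemma vf_br_anti X Y : vf_br X Y = vf_scale (-1) (vf_br Y X).
Proof. by apply: funext => k; rewrite /vf_scale /vf_br scaleN1r opprB. Qed.

Definition linform (a : 'rV[F]_n) : {mpoly F[n]} := \sum_j a 0 j *: 'X_j.

Lemma linform_lin e a b : linform (e *: a + b) = e *: linform a + linform b.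
Proof.
rewrite /linform scaler_sumr -big_split; apply: eq_bigr => j _ /=.
by rewrite !mxE scalerDl scalerA.
Qed.

Lemma linform_delta i : linform (delta_mx 0 i) = 'X_i.
Proof.
rewrite /linform (bigD1 i) //= big1 ?addr0 ?mxE ?eqxx ?scale1r // => j ji.
by rewrite mxE eqxx (negPf ji) scale0r.
Qed.

Lemma vf_apply_linform X a : vf_apply X (linform a) = \sum_j a 0 j *: X j.
Proof.
have Xd i : vf_apply X 'X_i = X i.
  rewrite /vf_apply (bigD1 i) //= big1 ?addr0 => [|j ji].
    rewrite mderivX mnm1E eqxx scale1r.
    have -> : (U_(i) - U_(i) = 0)%MM.
      by apply/mnmP => j; rewrite mnmBE subnn mnm0E.
    by rewrite mpolyX0 mulr1.
  by rewrite mderivX mnm1E eq_sym (negPf ji) scale0r mulr0.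
rewrite /linform; elim/big_rec2: _ => [|i y1 y2 _ <-]; first exact: vf_apply0.
by rewrite vf_apply_lin Xd.
Qed.

End VectorFields.

(** * Linear vector fields and Killing linear forms *)

Section Bracket.
Variables (F : numClosedFieldType) (n' : nat).
Local Notation n := n'.+1.
Variable (c : 'I_n -> 'I_n -> 'I_n -> F).

Definition fv (v : 'rV[F]_n) : lvec F n := fun i => v 0 i.

Lemma fvK (x : lvec F n) : fv (\row_i x i) = x.
Proof. by apply: funext => i; rewrite /fv mxE. Qed.

Definition lie_br (u v : 'rV[F]_n) : 'rV[F]_n := \row_k lbr c (fv u) (fv v) k.

Lemma lie_br_linl a x y z :
  lie_br (a *: x + y) z = a *: lie_br x z + lie_br y z.
Proof.
apply/rowP => k; rewrite !mxE /lbr mulr_sumr -big_split; apply: eq_bigr => i _.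
rewrite /= mulr_sumr -big_split; apply: eq_bigr => j _ /=.
by rewrite /fv !mxE; ring.
Qed.

Lemma lie_br_linr a x y z :
  lie_br z (a *: x + y) = a *: lie_br z x + lie_br z y.
Proof.
apply/rowP => k; rewrite !mxE /lbr mulr_sumr -big_split; apply: eq_bigr => i _.
rewrite /= mulr_sumr -big_split; apply: eq_bigr => j _ /=.
by rewrite /fv !mxE; ring.
Qed.

Hypothesis hlie : is_lie_algebra c.

Lemma lie_brxx x : lie_br x x = 0.
Proof. by apply/rowP => k; rewrite !mxE hlie.1. Qed.

Lemma fv_br x y : fv (lie_br x y) = lbr c (fv x) (fv y).
Proof. by rewrite /lie_br fvK. Qed.

Lemma lie_br_jacobi x y z :
  lie_br x (lie_br y z) + lie_br y (lie_br z x) + lie_br z (lie_br x y) = 0.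
Proof.
apply/rowP => k; have := congr1 (fun f => f k) (hlie.2 (fv x) (fv y) (fv z)).
by rewrite !mxE !fv_br.
Qed.

Lemma lie_brC x y : lie_br x y = - lie_br y x.
Proof. exact: (brC lie_br_linl lie_br_linr lie_brxx). Qed.

Lemma lie_br_leibniz x y z :
  lie_br x (lie_br y z) = lie_br (lie_br x y) z + lie_br y (lie_br x z).
Proof.
have := lie_br_jacobi x y z.
rewrite (lie_brC z x) (lie_brC z (lie_br x y)) -scaleN1r.
rewrite (brZr lie_br_linr) scaleN1r => /eqP.
by rewrite subr_eq0 subr_eq => /eqP.
Qed.

(** An abelian ideal is solvable: its first derived algebra is already 0. *)
Lemma semisimple_no_abelian_ideal : semisimple c ->
  forall A : 'rV[F]_n -> Prop, ideal lie_br A ->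
  (forall x y, A x -> A y -> lie_br x y = 0) -> forall x, A x -> x = 0.
Proof.
move=> hss A [[A0 Alin] Abr] Aab x Ax.
have rowE (v : 'rV[F]_n) : \row_i fv v i = v by apply/rowP => i; rewrite mxE.
suff : fv x = @lzero F n.
  by move=> x0; rewrite -[x]rowE x0; apply/rowP => i; rewrite !mxE.
apply: (hss (fun y : lvec F n => A (\row_i y i))); last by rewrite rowE.
  split; first split.
  - have -> // : \row_i lzero F i = 0 :> 'rV[F]_n.
    by apply/rowP => i; rewrite !mxE.
  - move=> a y z Ay Az; have := Alin a _ _ Ay Az.
    by congr A; apply/rowP => i; rewrite !mxE.
  move=> y z Az; have := Abr (\row_i y i) _ Az.
  by congr A; rewrite /lie_br !fvK.
exists 1%N => y /=; elim=> // [u v Au Av|a u v _ -> _ ->].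
  have := Aab _ _ Au Av; rewrite /lie_br !fvK => uv0.
  by apply: funext => k; have := congr1 (fun r => fv r k) uv0; rewrite /fv !mxE.
by apply: funext => k; rewrite /lcomb /lzero mulr0 addr0.
Qed.

Local Notation ad := (ad lie_br).
Local Notation killing := (killing lie_br).

Definition lin (v : 'rV[F]_n) : vfield F n := lin_vf c (fv v).

Lemma linE v k : lin v k = linform (\row_j ad v j k).
Proof.
rewrite /lin /lin_vf exchange_big; apply: eq_bigr => j _ /=.
rewrite -scaler_suml; congr (_ *: _); rewrite !mxE /lbr.
apply: eq_bigr => i _; rewrite (bigD1 j) //= big1 ?addr0.
  by rewrite /fv !mxE !eqxx /= mulr1.
by move=> l lj; rewrite /fv !mxE eqxx (negPf lj) /= mulr0 mul0r.
Qed.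

Lemma lin_lin a u v k : lin (a *: u + v) k = a *: lin u k + lin v k.
Proof.
rewrite !linE -linform_lin; congr linform.
by apply/rowP => j; rewrite (ad_lin lie_br_linl) !mxE.
Qed.

Lemma lin0 k : lin 0 k = 0.
Proof.
by have := lin_lin (-1) 0 0 k; rewrite scaler0 addr0 scaleN1r addNr.
Qed.

Lemma linZ a v k : lin (a *: v) k = a *: lin v k.
Proof. by rewrite -[a *: v]addr0 lin_lin lin0 addr0. Qed.

Lemma act_linform v a : vf_apply (lin v) (linform a) = linform (a *m (ad v)^T).
Proof.
rewrite vf_apply_linform /linform; under eq_bigr do rewrite linE scaler_sumr.
rewrite exchange_big; apply: eq_bigr => j _ /=.
rewrite !mxE scaler_suml; apply: eq_bigr => i _.
by rewrite !mxE scalerA.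
Qed.

(** The order is reversed because composing actions on functions reverses the composition of maps on
    points. *)
Lemma lin_br u v : vf_br (lin u) (lin v) = lin (lie_br v u).
Proof.
apply: funext => k; rewrite /vf_br !linE !act_linform.
rewrite -scaleN1r addrC -linform_lin; congr linform.
apply/rowP => j; rewrite (ad_br lie_br_linr lie_br_leibniz) !mxE mulN1r addrC.
by congr (_ - _); apply: eq_bigr => i _; rewrite !mxE mulrC.
Qed.

(** The linear form [K(y, .)]: [killing_mx] is the Gram matrix of the Killing form. *)
Definition kform (y : 'rV[F]_n) : {mpoly F[n]} := linform (y *m killing_mx lie_br).

Lemma kform_lin a y z : kform (a *: y + z) = a *: kform y + kform z.
Proof. by rewrite /kform mulmxDl -scalemxAl linform_lin. Qed.

Lemma kformZ a y : kform (a *: y) = a *: kform y.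
Proof.
have k0 : kform 0 = 0.
  by have := kform_lin (-1) 0 0; rewrite scaler0 addr0 scaleN1r addNr.
by rewrite -[a *: y]addr0 kform_lin k0 addr0.
Qed.

(** Invariance of the Killing form: [K(y, [v, p]) = K([y, v], p)]. *)
Lemma act_kform v y : vf_apply (lin v) (kform y) = kform (lie_br y v).
Proof.
rewrite /kform act_linform; congr linform; apply/rowP => j.
rewrite (mul_killing_mx lie_br_linl).
rewrite (killing_br lie_br_linl lie_br_linr lie_brxx lie_br_leibniz).
rewrite (killing_mxE lie_br_linl) -(mul_ad lie_br_linr) !mxE.
by apply: eq_bigr => i _; rewrite -rowE !mxE.
Qed.

Lemma act_self y : vf_apply (lin y) (kform y) = 0.
Proof.
by rewrite act_kform lie_brxx -[0](scale0r 0) kformZ scale0r.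
Qed.

Local Notation L := (lie_generated (overshear c)).

Definition gen (f : {mpoly F[n]}) v := L (vf_smul f (lin v)).

Lemma lg_eq X Y : L X -> X =1 Y -> L Y.
Proof. by move=> LX /funext <-. Qed.

Lemma gen_overshear f v :
  vf_apply (lin v) (vf_apply (lin v) f) = 0 -> gen f v.
Proof. by move=> f0; apply: lg_base; exists f, (fv v). Qed.

Lemma gen_lin a f g v : gen f v -> gen g v -> gen (a *: f + g) v.
Proof.
move=> Gf Gg; apply: lg_eq (lg_add (lg_scale a Gf) Gg) _ => k.
by rewrite /vf_add /vf_scale /vf_smul mulrDl scalerAl.
Qed.

Lemma gen0 v : gen 0 v.
Proof. by apply: gen_overshear; rewrite !vf_apply0. Qed.

Lemma genZ a f v : gen f v -> gen (a *: f) v.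
Proof. by move=> Gf; rewrite -[_ *: _]addr0; apply: gen_lin => //; apply: gen0. Qed.

Lemma genZ_inv a f v : a != 0 -> gen (a *: f) v -> gen f v.
Proof. by move=> a0 /(genZ a^-1); rewrite scalerA mulVf // scale1r. Qed.

Lemma gen_linr a f u v : gen f u -> gen f v -> gen f (a *: u + v).
Proof.
move=> Gu Gv; apply: lg_eq (lg_add (lg_scale a Gu) Gv) _ => k.
by rewrite /vf_add /vf_scale /vf_smul lin_lin mulrDr scalerAr.
Qed.

Lemma gen_bracket f g v : gen f v -> gen g v ->
  gen (f * vf_apply (lin v) g - g * vf_apply (lin v) f) v.
Proof.
move=> Gf Gg; apply: lg_eq (lg_br Gf Gg) _ => k.
by rewrite vf_br_smul lin_br lie_brxx /vf_smul mulrBl lin0 mulr0 addr0.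
Qed.

(** The field [lin u] is an overshear with coefficient 1, so bracketing with it stays in [L]. *)
Lemma gen_act g u v : gen g v ->
  L (vf_add (vf_smul (vf_apply (lin u) g) (lin v))
            (vf_smul g (lin (lie_br v u)))).
Proof.
move=> Gg; have G1 : gen 1 u by apply: gen_overshear; rewrite vf_apply1 vf_apply0.
apply: lg_eq (lg_br G1 Gg) _ => k.
by rewrite vf_br_smul lin_br /vf_smul /vf_add vf_apply1 mulr0 mul0r subr0 !mul1r.
Qed.

Lemma lg_cancel X Y : L (vf_add X Y) -> L Y -> L X.
Proof.
move=> LXY LY; apply: lg_eq (lg_add LXY (lg_scale (-1) LY)) _ => k.
by rewrite /vf_add /vf_scale scaleN1r addrK.
Qed.

(** Bracketing [f y] with [x] gives [x(f) y + f [y, x]], whose first term is in [L] because any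
    coefficient is allowed in front of [y]. *)
Lemma gen_ideal : ideal lie_br (fun v => forall f, gen f v).
Proof.
split; first split.
- by move=> f; apply: lg_eq (lg_zero _) _ => k; rewrite /vf_smul lin0 mulr0.
- by move=> a x y Gx Gy f; apply: gen_linr.
move=> x y Gy f; have /lg_cancel : L (vf_add (vf_smul f (lin (lie_br y x)))
    (vf_smul (vf_apply (lin x) f) (lin y))).
  by apply: lg_eq (gen_act x (Gy f)) _ => k; rewrite /vf_add addrC.
move=> /(_ (Gy _)) /(lg_scale (-1)) G; apply: lg_eq G _ => k.
by rewrite /vf_scale /vf_smul [lie_br x y]lie_brC -[- lie_br y x]scaleN1r linZ scalerAr.
Qed.

(** * Fields along an ad-diagonalizable element *)

Section Diagonalizable.
Variable x : 'rV[F]_n.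

Definition eigen (a : F) y := lie_br x y = a *: y.

Lemma eigen_lin a e y z : eigen a y -> eigen a z -> eigen a (e *: y + z).
Proof.
by rewrite /eigen lie_br_linr => -> ->; rewrite scalerDr !scalerA mulrC.
Qed.

Lemma act_eigen a y : eigen a y -> vf_apply (lin x) (kform y) = - a *: kform y.
Proof. by move=> ya; rewrite act_kform lie_brC ya -scaleNr kformZ. Qed.

Lemma act_eigenx a y : eigen a y -> vf_apply (lin y) (kform x) = a *: kform y.
Proof. by move=> ya; rewrite act_kform ya kformZ. Qed.

(** If [a = 0], then [x] kills [l_y]. Otherwise [[y, l_x x] = a l_y x + a l_x y], and [l_x y] is an
    overshear since [y] maps [l_x] to [a l_y] and kills [l_y]. *)
Lemma gen_kform a y : eigen a y -> gen (kform y) x.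
Proof.
move=> ya; have [a0|a_neq0] := eqVneq a 0.
  by apply: gen_overshear; rewrite (act_eigen ya) a0 oppr0 scale0r vf_apply0.
have Gxx : gen (kform x) x.
  by apply: gen_overshear; rewrite act_self vf_apply0.
have Gxy : gen (kform x) y.
  by apply: gen_overshear; rewrite (act_eigenx ya) vf_applyZ act_self scaler0.
apply: (genZ_inv a_neq0); rewrite -(act_eigenx ya).
apply: lg_cancel (gen_act y Gxx) _.
apply: lg_eq (lg_scale a Gxy) _ => k.
by rewrite ya /vf_scale /vf_smul linZ scalerAr.
Qed.

Lemma gen_kform_sq a y : eigen a y -> gen (kform y * kform y) x.
Proof.
move=> ya; have [a0|a_neq0] := eqVneq a 0.
  apply: gen_overshear.
  by rewrite vf_applyM (act_eigen ya) a0 oppr0 scale0r mulr0 addr0 vf_apply0.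
have Gxyx : gen (kform y * kform x) x.
  have Gxx : gen (kform x) x.
    by apply: gen_overshear; rewrite act_self vf_apply0.
  have := gen_bracket (gen_kform ya) Gxx.
  rewrite act_self mulr0 sub0r (act_eigen ya) scaleNr mulrN opprK -scalerAr.
  by rewrite mulrC; apply: genZ_inv.
have Gxyy : gen (kform y * kform x) y.
  apply: gen_overshear; rewrite vf_applyM act_self mulr0 addr0 (act_eigenx ya).
  by rewrite -scalerAr vf_applyZ vf_applyM act_self mulr0 addr0 scaler0.
(* [[y, l_x l_y x] = a l_y^2 x + a l_x l_y y], and [Gxyy] removes the last term. *)
apply: (genZ_inv a_neq0); rewrite scalerAr -(act_eigenx ya).
have := gen_act y Gxyx; rewrite vf_applyM act_self mulr0 addr0.
move=> /lg_cancel; apply; apply: lg_eq (lg_scale a Gxyy) _ => k.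
by rewrite ya /vf_scale /vf_smul linZ scalerAr.
Qed.

(** Polarization of squares: the bracket of [l_y x] and [l_z x] is 0 when the weights agree, so it
    cannot produce this product. *)
Lemma gen_kform2 a y z : eigen a y -> eigen a z -> gen (kform y * kform z) x.
Proof.
move=> ya za; have yza := eigen_lin 1 ya za.
have two0 : 2%:R != 0 :> F by rewrite pnatr_eq0.
apply: (genZ_inv two0).
have -> : 2%:R *: (kform y * kform z) = -1 *: (kform y * kform y) +
    (-1 *: (kform z * kform z) + kform (1 *: y + z) * kform (1 *: y + z)).
  by rewrite kform_lin scale1r !scaleN1r scaler_nat; ring.
by do !apply: gen_lin; apply: gen_kform_sq; eassumption.
Qed.

Definition kprod (s : seq ('rV[F]_n * F)) := \prod_(p <- s) kform p.1.

Definition eigens (s : seq ('rV[F]_n * F)) := forall p, p \in s -> eigen p.2 p.1.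

Lemma act_kprod s : eigens s ->
  vf_apply (lin x) (kprod s) = - (\sum_(p <- s) p.2) *: kprod s.
Proof.
rewrite /kprod; elim: s => [|p s IHs] es.
  by rewrite !big_nil vf_apply1 oppr0 scale0r.
rewrite !big_cons vf_applyM (act_eigen (es p _)) ?mem_head // IHs.
  by rewrite opprD scalerDl -!scalerAr addrC [kform _ * _]mulrC.
by move=> q qs; apply: es; rewrite inE qs orbT.
Qed.

Lemma gen_kprod s : eigens s -> gen (kprod s) x.
Proof.
have [m] := ubnP (size s); elim: m s => // m IHm s; rewrite ltnS => sm es.
pose t := \sum_(p <- s) p.2.
have [allt|/allPn [p ps pt]] := boolP (all (fun p => t == p.2 + p.2) s).
  (* Summing [t = p.2 + p.2] over all factors leaves only [t = 0], which includes the empty product,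
     or two factors. *)
  have tE : t *+ size s = t + t.
    rewrite -[RHS]big_split /= (eq_big_seq (fun=> t)) => [|p ps]; last first.
      by apply/esym/eqP/(allP allt).
    by rewrite big_const_seq count_predT iter_addr_0.
  have [t0|t_neq0] := eqVneq t 0.
    by apply: gen_overshear; rewrite act_kprod // -/t t0 oppr0 scale0r vf_apply0.
  have s2 : size s = 2%N.
    apply/eqP; rewrite -(eqr_nat F); apply/eqP/(mulIf t_neq0).
    by rewrite !mulr_natl tE mulr2n.
  clear tE sm IHm; rewrite /kprod.
  case: s s2 @t allt es t_neq0 => [|p [|q []]] // _ t /and3P[/eqP tp /eqP tq _] es _.
  rewrite !big_cons big_nil mulr1.
  have pq : p.2 = q.2.
    apply: (mulIf (_ : 2%:R != 0)); first by rewrite pnatr_eq0.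
    by rewrite !mulr_natr !mulr2n -tp tq.
  apply: (gen_kform2 (a := p.2)); first by apply: es; rewrite inE eqxx.
  by rewrite pq; apply: es; rewrite !inE eqxx orbT.
have sE := perm_to_rem ps.
have -> : kprod s = kform p.1 * kprod (rem p s).
  by rewrite /kprod (perm_big _ sE) big_cons.
have er : eigens (rem p s) by move=> q /mem_rem; apply: es.
have Gr : gen (kprod (rem p s)) x.
  apply: IHm => //; move: sm; rewrite (perm_size sE) /=; exact.
(* This bracket is the full product times [p.2 + p.2 - t], nonzero by the choice of [p]. *)
have := gen_bracket (gen_kform (es p ps)) Gr.
rewrite act_kprod // (act_eigen (es p ps)).
have -> : \sum_(q <- rem p s) q.2 = t - p.2.
  by rewrite /t (perm_big _ sE) big_cons addrC addKr.
rewrite -!scalerAr [kprod _ * _]mulrC -scalerBl; apply: genZ_inv.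
by rewrite opprB opprK addrAC subr_eq0 eq_sym.
Qed.

Hypothesis hss : semisimple c.

Lemma kform_surj i : exists y, kform y = 'X_i.
Proof.
exists (delta_mx 0 i *m invmx (killing_mx lie_br)); rewrite /kform mulmxKV.
  exact: linform_delta.
exact: (killing_mx_unit lie_br_linl lie_br_linr lie_brxx lie_br_leibniz
         (semisimple_no_abelian_ideal hss)).
Qed.

Lemma gen_diagonalizable : ad_diagonalizable lie_br x -> forall f, gen f x.
Proof.
move=> xdiag.
(* [ad_diagonalizable] applies to additive predicates of a single vector, so factors are treated one
   at a time: [T] leaves room for further eigenforms, and [Q (kform y)] is additive in [y]. *)
pose T f := forall s, eigens s -> gen (kprod s * f) x.
have Tlin a f g : T f -> T g -> T (a *: f + g).
  move=> Tf Tg s es; rewrite mulrDr -scalerAr.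
  by apply: gen_lin; [apply: Tf|apply: Tg].
pose Q q := forall f, T f -> T (q * f).
have QM p q : Q p -> Q q -> Q (p * q).
  by move=> Qp Qq f Tf; rewrite -mulrA; apply/Qp/Qq.
have Q1 : Q 1 by move=> f; rewrite mul1r.
have Qk : forall y, Q (kform y).
  apply: xdiag => [u v Qu Qv f Tf|y a ya f Tf s es].
    rewrite -[u]scale1r kform_lin mulrDl -scalerAl.
    by apply: Tlin; [apply: Qu|apply: Qv].
  rewrite mulrCA -[kform y]/(kform (y, a).1).
  have -> : kform (y, a).1 * (kprod s * f) = kprod ((y, a) :: s) * f.
    by rewrite /kprod big_cons mulrA.
  apply: Tf => p; rewrite inE => /orP[/eqP -> //|]; exact: es.
have T1 : T 1 by move=> s es; rewrite mulr1; apply: gen_kprod.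
have T0 : T 0 by move=> s _; rewrite mulr0; apply: gen0.
have Tall f : T f.
  rewrite [f]mpolyE; elim/big_ind: _ => [//|p q Tp Tq|m _].
    by rewrite -[p]scale1r; apply: Tlin.
  rewrite -[_ *: _]addr0; apply: Tlin => //; rewrite -[_ m]mulr1 mpolyXE_id.
  have : Q (\prod_(i < n) 'X_i ^+ m i); last exact.
  apply: (big_ind Q) => // i _; have [y yi] := kform_surj i.
  by elim: (m i) => [//|k IHk]; rewrite exprS; apply: QM => //; rewrite -yi.
by move=> f; have := Tall f [::]; rewrite /kprod big_nil mul1r; apply.
Qed.

End Diagonalizable.

(** * The two inclusions *)

Lemma tensor_vf_ind (P : vfield F n -> Prop) :
  P (@vf_zero F n) -> (forall X Y, P X -> P Y -> P (vf_add X Y)) ->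
  (forall f v, P (vf_smul f (lin v))) -> forall X, tensor_vf c X -> P X.
Proof.
move=> P0 PD Pf X [m [f [xi ->]]].
elim: (index_enum _) => [|l r IHr].
  by under eq_fun do rewrite big_nil.
under eq_fun do rewrite big_cons.
by apply: PD IHr; rewrite -(fvK (xi l)); apply: Pf.
Qed.

Lemma tensor_smul f v : tensor_vf c (vf_smul f (lin v)).
Proof.
exists 1%N, (fun=> f), (fun=> fv v); apply: funext => k.
by rewrite big_ord1.
Qed.

Lemma tensor_zero : tensor_vf c (@vf_zero F n).
Proof.
exists 0%N, (fun=> 0), (fun=> fv 0); apply: funext => k.
by rewrite big_ord0.
Qed.

Lemma tensor_add X Y :
  tensor_vf c X -> tensor_vf c Y -> tensor_vf c (vf_add X Y).
Proof.
move=> [m1 [f1 [xi1 ->]]] [m2 [f2 [xi2 ->]]].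
exists (m1 + m2)%N.
exists (fun l => match split l with inl i => f1 i | inr i => f2 i end).
exists (fun l => match split l with inl i => xi1 i | inr i => xi2 i end).
apply: funext => k; rewrite /vf_add big_split_ord; congr (_ + _).
  by apply: eq_bigr => i _; rewrite (unsplitK (inl i)).
by apply: eq_bigr => i _; rewrite (unsplitK (inr i)).
Qed.

Lemma tensor_scale a X : tensor_vf c X -> tensor_vf c (vf_scale a X).
Proof.
move=> [m [f [xi ->]]]; exists m, (fun l => a *: f l), xi.
apply: funext => k; rewrite /vf_scale scaler_sumr.
by apply: eq_bigr => l _; rewrite scalerAl.
Qed.

(** By additivity and antisymmetry it suffices to expand [[f u, g v]], which has three terms of the
    required form. *)
Lemma tensor_br X Y :
  tensor_vf c X -> tensor_vf c Y -> tensor_vf c (vf_br X Y).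
Proof.
have br0 Z : vf_br (@vf_zero F n) Z = @vf_zero F n.
  apply: funext => k; rewrite /vf_br vf_apply0 subr0.
  by rewrite /vf_apply big1 // => j _; rewrite mul0r.
move=> TX TY; move: X TX; apply: tensor_vf_ind => [|X1 X2 T1 T2|f u].
- by rewrite br0; apply: tensor_zero.
- by rewrite vf_br_addl; apply: tensor_add.
rewrite vf_br_anti; apply: tensor_scale.
move: Y TY; apply: tensor_vf_ind => [|Y1 Y2 T1 T2|g v].
- by rewrite br0; apply: tensor_zero.
- by rewrite vf_br_addl; apply: tensor_add.
rewrite vf_br_smul lin_br.
have := tensor_add (tensor_add (tensor_smul (g * vf_apply (lin v) f) u)
  (tensor_smul (- (f * vf_apply (lin u) g)) v))
  (tensor_smul (g * f) (lie_br u v)).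
congr (tensor_vf c _); apply: funext => k.
by rewrite /vf_add /vf_smul mulNr.
Qed.

Lemma generated_tensor X : L X -> tensor_vf c X.
Proof.
elim=> {X} [X [f [xi [_ ->]]]||X Y _ TX _ TY|a X _ TX|X Y _ TX _ TY].
- by rewrite -(fvK xi); apply: tensor_smul.
- exact: tensor_zero.
- exact: tensor_add.
- exact: tensor_scale.
exact: tensor_br.
Qed.

Hypothesis hss : semisimple c.

Lemma gen_all f v : gen f v.
Proof.
move: v f; apply: (diagonalizable_ideal lie_br_linl lie_br_linr lie_brxx
  lie_br_leibniz (semisimple_no_abelian_ideal hss) gen_ideal) => d.
exact: gen_diagonalizable.
Qed.

Lemma tensor_generated X : tensor_vf c X -> L X.
Proof.
move: X; apply: tensor_vf_ind => [|X Y LX LY|f v]; first exact: lg_zero.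
  exact: lg_add.
exact: gen_all.
Qed.

End Bracket.

Theorem theorem4p6 (R : realType) (n : nat) (c : 'I_n -> 'I_n -> 'I_n -> R[i])
    (hlie : is_lie_algebra c) (hss : semisimple c) :
  forall X : vfield R[i] n,
    lie_generated (overshear c) X <-> tensor_vf c X.
Proof.
(* The matrix arguments live in dimension [n.+1]; in dimension 0 the only vector field is 0. *)
case: n c hlie hss => [|n] c hlie hss X; last first.
  by split; [apply: generated_tensor | apply: tensor_generated].
have -> : X = @vf_zero _ 0 by apply: funext => -[].
split=> _; last exact: lg_zero.
by exists 0%N, (fun=> 0), (fun=> @lzero _ 0); apply: funext => -[].
Qed.
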